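(* Let $\mathfrak{g}$ be a Lie algebra with a representation $\alpha$ on a vector space $V$, let $\mathfrak{g}\ltimes V$ be the semidirect product Lie algebra, and let $(\mathfrak{g}\ltimes V)\ltimes(\mathfrak{g}\ltimes V)$ be its self-semidirect product. Then for $((\xi_h,f),(\xi_k,h))\in(\mathfrak{g}\ltimes V)\ltimes(\mathfrak{g}\ltimes V)$ and $((m,l),(n,o))$ in the dual space, the coadjoint operator $\operatorname{ad}^*_{((\xi_h,f),(\xi_k,h))}((m,l),(n,o))$ equals $$\Big(\big(\operatorname{ad}^*_{\xi_h}m+l\diamond f+\operatorname{ad}^*_{\xi_k}n+o\diamond h,\ \alpha^*(\xi_h)l+\alpha^*(\xi_k)o\big),\ \big(\operatorname{ad}^*_{\xi_h+\xi_k}n+o\diamond(f+h),\ \alpha^*(\xi_h+\xi_k)o\big)\Big).$$ Consequently the Euler–Poincaré equations on $(\mathfrak{g}\ltimes V)\ltimes(\mathfrak{g}\ltimes V)$ are $$\frac{dm}{dt}=-\operatorname{ad}^*_{\xi_h}m-l\diamond f-\operatorname{ad}^*_{\xi_k}n-o\diamond h,\qquad \frac{dl}{dt}=-\alpha^*(\xi_h)l-\alpha^*(\xi_k)o,$$ $$\frac{dn}{dt}=-\operatorname{ad}^*_{\xi_h+\xi_k}n-o\diamond(f+h),\qquad \frac{do}{dt}=-\alpha^*(\xi_h+\xi_k)o.$$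
   Context: Write $\operatorname{ad}_\xi\eta=[\xi,\eta]$ and $\xi\cdot v=\alpha(\xi)v$ for $\xi\in\mathfrak{g}$, $v\in V$. The semidirect product $\mathfrak{g}\ltimes V$ is $\mathfrak{g}\times V$ with bracket $\operatorname{ad}_{(\xi,v)}(\eta,w)=(\operatorname{ad}_\xi\eta,\ \xi\cdot w-\eta\cdot v)$. For a Lie algebra $\mathfrak{a}$, the self-semidirect product $\mathfrak{a}\ltimes\mathfrak{a}$ is $\mathfrak{a}\times\mathfrak{a}$ with bracket $$\operatorname{ad}_{(X,Y)}(Z,W)=\big(\operatorname{ad}_X Z,\ \operatorname{ad}_{X+Y}(Z+W)-\operatorname{ad}_X Z\big)$$ (this is the Lie algebra of the semidirect product of a Lie group with itself, acting by conjugation). Duals are taken with respect to nondegenerate pairings, and pairings on products are sums of componentwise pairings: $\langle(m,l),(\xi,v)\rangle=\langle m,\xi\rangle_{\mathfrak{g}^*\times\mathfrak{g}}+\langle l,v\rangle_{V^*\times V}$ on $\mathfrak{g}\ltimes V$, and $\langle(M,N),(X,Y)\rangle=\langle M,X\rangle+\langle N,Y\rangle$ on the self-semidirect product. The coadjoint operator is defined by $\langle\operatorname{ad}^*_\xi\mu,\eta\rangle=\langle\mu,\operatorname{ad}_\xi\eta\rangle$. The map $\alpha^*:\mathfrak{g}\times V^*\to V^*$ is defined by $\langle\alpha^*(\xi)l,w\rangle_{V^*\times V}=\langle l,\alpha(\xi)w\rangle_{V^*\times V}$, and $\diamond:V^*\times V\to\mathfrak{g}^*$ is defined by $\langle l\diamond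 v,\eta\rangle_{\mathfrak{g}^*\times\mathfrak{g}}=-\langle l,\alpha(\eta)v\rangle_{V^*\times V}$. The operators $\operatorname{ad}^*$ on $\mathfrak{g}^*$, $\alpha^*$ and $\diamond$ are assumed to exist (automatic in finite dimensions). The Euler–Poincaré equation on a Lie algebra $\mathfrak{a}$ with Lagrangian $\ell:\mathfrak{a}\to\mathbb{R}$ is $\frac{d}{dt}\mu+\operatorname{ad}^*_\zeta\mu=0$ for a differentiable curve $\zeta(t)\in\mathfrak{a}$ with momentum $\mu=\frac{\delta\ell}{\delta\zeta}\in\mathfrak{a}^*$. Here $\zeta=((\xi_h,f),(\xi_k,h))$ and $\mu=((m,l),(n,o))$. *)

(* Defs.v *)
From mathcomp Require Import all_boot all_order all_algebra sesquilinear.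
From mathcomp Require Import boolp classical_sets reals topology normedtype.
From mathcomp Require Import derive.

Set Implicit Arguments.
Unset Strict Implicit.
Unset Printing Implicit Defensive.

Import Order.TTheory GRing.Theory Num.Theory.
Import numFieldNormedType.Exports.

Local Open Scope ring_scope.
Local Open Scope classical_set_scope.

(* The adjoint operator [ad_x y] is the value [B x y] of the bracket [B]. *)
Record lieBracket (R : realType) (a : lmodType R) := LieBracket {
  lie_op :> a -> a -> a;
  lie_bilinear : bilinear_for *:%R *:%R lie_op;
  lie_alternating : forall x, lie_op x x = 0;
  lie_jacobi : forall x y z,
    lie_op x (lie_op y z) + lie_op y (lie_op z x) + lie_op z (lie_op x y) = 0
}.

Record lieRep (R : realType) (a : lmodType R) (B : lieBracket a)
    (V : lmodType R) := LieRep {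
  rep_op :> a -> V -> V;
  rep_bilinear : bilinear_for *:%R *:%R rep_op;
  rep_bracket : forall x y v,
    rep_op (B x y) v = rep_op x (rep_op y v) - rep_op y (rep_op x v)
}.

Record pairing (R : realType) (a' a : lmodType R) := Pairing {
  pair_op :> a' -> a -> R;
  pair_bilinear : bilinear_for *%R *%R pair_op;
  pair_nondegl : forall mu, (forall x, pair_op mu x = 0) -> mu = 0;
  pair_nondegr : forall x, (forall mu, pair_op mu x = 0) -> x = 0
}.

Section BilinearTheory.
Variables (R : realType) (U U' W : lmodType R) (f : U -> U' -> W).
Hypothesis f_bil : bilinear_for *:%R *:%R f.

Let fDZl k x y z : f (k *: x + y) z = k *: f x z + f y z.
Proof. exact: f_bil.1. Qed.
Let fDZr k x y z : f z (k *: x + y) = k *: f z x + f z y.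
Proof. exact: f_bil.2. Qed.

Lemma bil_Dl x y z : f (x + y) z = f x z + f y z.
Proof. by have := fDZl 1 x y z; rewrite !scale1r. Qed.
Lemma bil_Dr x y z : f z (x + y) = f z x + f z y.
Proof. by have := fDZr 1 x y z; rewrite !scale1r. Qed.
Lemma bil_0l z : f 0 z = 0.
Proof. by apply: (addrI (f 0 z)); rewrite -bil_Dl !addr0. Qed.
Lemma bil_0r z : f z 0 = 0.
Proof. by apply: (addrI (f z 0)); rewrite -bil_Dr !addr0. Qed.
Lemma bil_Zl k x z : f (k *: x) z = k *: f x z.
Proof. by have := fDZl k x 0 z; rewrite !addr0 bil_0l addr0. Qed.
Lemma bil_Zr k x z : f z (k *: x) = k *: f z x.
Proof. by have := fDZr k x 0 z; rewrite !addr0 bil_0r addr0. Qed.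
Lemma bil_Nl x z : f (- x) z = - f x z.
Proof. by rewrite -scaleN1r bil_Zl scaleN1r. Qed.
Lemma bil_Nr x z : f z (- x) = - f z x.
Proof. by rewrite -scaleN1r bil_Zr scaleN1r. Qed.

End BilinearTheory.

Lemma lie_antisym (R : realType) (a : lmodType R) (B : lieBracket a) x y :
  B x y = - B y x.
Proof.
have := lie_alternating B (x + y).
rewrite !(bil_Dl (lie_bilinear B)) !(bil_Dr (lie_bilinear B)).
by rewrite !lie_alternating add0r addr0 => /eqP; rewrite addr_eq0 => /eqP.
Qed.

Section Semidirect.
Variables (R : realType) (g V : lmodType R) (B : lieBracket g).
Variable alpha : lieRep B V.

Definition semidirect_op (x y : g * V) : g * V :=
  (B x.1 y.1, alpha x.1 y.2 - alpha y.1 x.2).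

Let BB := lie_bilinear B.
Let AA := rep_bilinear alpha.

Lemma semidirect_bilinear : bilinear_for *:%R *:%R semidirect_op.
Proof.
split=> [[y v] k [x u] [x' u']|[y v] k [x u] [x' u']];
  rewrite /semidirect_op; congr (_, _) => /=.
- by rewrite (bil_Dl BB) (bil_Zl BB).
- rewrite (bil_Dl AA) (bil_Zl AA) (bil_Dr AA) (bil_Zr AA).
  by rewrite opprD addrACA scalerBr.
- by rewrite (bil_Dr BB) (bil_Zr BB).
- rewrite (bil_Dl AA) (bil_Zl AA) (bil_Dr AA) (bil_Zr AA).
  by rewrite opprD addrACA scalerBr.
Qed.

Lemma semidirect_alternating x : semidirect_op x x = 0.
Proof. by rewrite /semidirect_op lie_alternating subrr. Qed.

Lemma semidirect_jacobi x y z :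
  semidirect_op x (semidirect_op y z) + semidirect_op y (semidirect_op z x)
  + semidirect_op z (semidirect_op x y) = 0.
Proof.
case: x y z => [x u] [y v] [z w]; congr (_, _) => /=; first exact: lie_jacobi.
rewrite !(bil_Dr AA) !(bil_Nr AA) !rep_bracket.
move: (alpha x (alpha y w)) (alpha x (alpha z v)) (alpha y (alpha z u))
  (alpha y (alpha x w)) (alpha z (alpha x v)) (alpha z (alpha y u)).
move=> p q r s t k; rewrite !opprD !opprK !addrA.
rewrite [LHS](ACl ((1*11)*(8*2)*(5*3)*(4*10)*(12*6)*(9*7)))/=.
by rewrite !subrr !addr0.
Qed.

Definition semidirect : lieBracket (g * V)%type :=
  LieBracket semidirect_bilinear semidirect_alternating semidirect_jacobi.

End Semidirect.

Section SelfSemidirect.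
Variables (R : realType) (a : lmodType R) (B : lieBracket a).

Definition self_semidirect_op (x y : a * a) : a * a :=
  (B x.1 y.1, B (x.1 + x.2) (y.1 + y.2) - B x.1 y.1).

Let BB := lie_bilinear B.

Lemma self_semidirect_bilinear : bilinear_for *:%R *:%R self_semidirect_op.
Proof.
split=> [[y v] k [x u] [x' u']|[y v] k [x u] [x' u']];
  rewrite /self_semidirect_op; congr (_, _) => /=.
- by rewrite (bil_Dl BB) (bil_Zl BB).
- rewrite addrACA -scalerDr (bil_Dl BB (k *: (x + u))) (bil_Dl BB (k *: x)).
  by rewrite !(bil_Zl BB) opprD addrACA scalerBr.
- by rewrite (bil_Dr BB) (bil_Zr BB).
- rewrite addrACA -scalerDr (bil_Dr BB (k *: (x + u))) (bil_Dr BB (k *: x)).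
  by rewrite !(bil_Zr BB) opprD addrACA scalerBr.
Qed.

Lemma self_semidirect_alternating x : self_semidirect_op x x = 0.
Proof. by rewrite /self_semidirect_op !lie_alternating subrr. Qed.

Lemma self_semidirect_jacobi x y z :
  self_semidirect_op x (self_semidirect_op y z)
  + self_semidirect_op y (self_semidirect_op z x)
  + self_semidirect_op z (self_semidirect_op x y) = 0.
Proof.
congr (_, _) => /=; first exact: lie_jacobi.
have K (p q : a) : p + (q - p) = q by rewrite addrC subrK.
rewrite !K !addrA [LHS](ACl ((1*3*5)*(2*4*6)))/= -!opprD.
by rewrite !lie_jacobi subrr.
Qed.

Definition self_semidirect : lieBracket (a * a)%type :=
  LieBracket self_semidirect_bilinear self_semidirect_alternating
    self_semidirect_jacobi.

End SelfSemidirect.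

Section ProdPairing.
Variables (R : realType) (a' a b' b : lmodType R).
Variables (P : pairing a' a) (Q : pairing b' b).

Definition prod_pairing_op (mu : a' * b') (x : a * b) : R :=
  P mu.1 x.1 + Q mu.2 x.2.

Lemma pair0l c' c (S : @pairing R c' c) x : S 0 x = 0.
Proof.
have := (pair_bilinear S).1 x (-1) 0 0.
by rewrite /= scaler0 addr0 mulN1r addNr.
Qed.

Lemma pair0r c' c (S : @pairing R c' c) mu : S mu 0 = 0.
Proof.
have := (pair_bilinear S).2 mu (-1) 0 0.
by rewrite /= scaler0 addr0 mulN1r addNr.
Qed.

Lemma prod_pairing_bilinear : bilinear_for *%R *%R prod_pairing_op.
Proof.
split=> [x k mu nu|mu k x y]; rewrite /prod_pairing_op /=.
- rewrite [P _ _](pair_bilinear P).1 [Q _ _](pair_bilinear Q).1.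
  by rewrite addrACA mulrDr.
- rewrite [P _ _](pair_bilinear P).2 [Q _ _](pair_bilinear Q).2.
  by rewrite addrACA mulrDr.
Qed.

Lemma prod_pairing_nondegl mu : (forall x, prod_pairing_op mu x = 0) -> mu = 0.
Proof.
case: mu => m n mn0; congr (_, _).
- apply: (pair_nondegl (p := P)) => x.
  by have := mn0 (x, 0); rewrite /prod_pairing_op /= pair0r addr0.
- apply: (pair_nondegl (p := Q)) => x.
  by have := mn0 (0, x); rewrite /prod_pairing_op /= pair0r add0r.
Qed.

Lemma prod_pairing_nondegr x : (forall mu, prod_pairing_op mu x = 0) -> x = 0.
Proof.
case: x => x y xy0; congr (_, _).
- apply: (pair_nondegr (p := P)) => m.
  by have := xy0 (m, 0); rewrite /prod_pairing_op /= pair0l addr0.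
- apply: (pair_nondegr (p := Q)) => m.
  by have := xy0 (0, m); rewrite /prod_pairing_op /= pair0l add0r.
Qed.

Definition prod_pairing : pairing (a' * b')%type (a * b)%type :=
  Pairing prod_pairing_bilinear prod_pairing_nondegl prod_pairing_nondegr.

End ProdPairing.

(* [ad*], [alpha*] and the diamond need not exist in infinite dimension, so each
   is a map required to satisfy its defining identity; by nondegeneracy of the
   pairings at most one map does. *)
Definition is_coadjoint (R : realType) (a' a : lmodType R) (B : lieBracket a)
    (P : pairing a' a) (coad : a -> a' -> a') : Prop :=
  forall x mu y, P (coad x mu) y = P mu (B x y).

Definition is_dual_action (R : realType) (g V V' : lmodType R)
    (B : lieBracket g) (alpha : lieRep B V) (PV : pairing V' V)
    (alphas : g -> V' -> V') : Prop :=
  forall x l w, PV (alphas x l) w = PV l (alpha x w).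

Definition is_diamond (R : realType) (g g' V V' : lmodType R)
    (B : lieBracket g) (alpha : lieRep B V) (Pg : pairing g' g)
    (PV : pairing V' V) (diamond : V' -> V -> g') : Prop :=
  forall l v y, Pg (diamond l v) y = - PV l (alpha y v).

(* The library's [is_derive] is restricted to normed spaces; this is the same
   limit of difference quotients with values in a locally convex space.  It is
   stated as a convergence, so no separation axiom is needed to make sense of
   it. *)
Definition is_curve_derive (R : realType) (W : tvsType R) (c : R -> W) (t : R)
    (d : W) : Prop :=
  (fun s : R => s^-1 *: (c (s + t) - c t)) @ 0^' --> d.

Definition curve_derivable (R : realType) (W : tvsType R) (c : R -> W)
    (t : R) : Prop :=
  exists d, is_curve_derive c t d.

(* [mu] is the variational derivative of [ell] at [z] :
   <mu, y> = d/ds ell (z + s y) at s = 0, for every y. *)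
Definition is_variational_derivative (R : realType) (a' a : lmodType R)
    (P : pairing a' a) (ell : a -> R) (z : a) (mu : a') : Prop :=
  forall y, is_derive (0 : R) 1 (fun s : R => ell (z + s *: y)) (P mu y).

(* d mu / dt + ad*_zeta mu = 0 at time t, including the existence of
   d mu / dt. *)
Definition euler_poincare_at (R : realType) (a' : tvsType R) (a : lmodType R)
    (coad : a -> a' -> a') (zeta : R -> a) (mu : R -> a') (t : R) : Prop :=
  exists2 dmu, is_curve_derive mu t dmu & dmu + coad (zeta t) (mu t) = 0.

(* Main.v *)
Require Import Defs.
From mathcomp Require Import all_boot all_order all_algebra sesquilinear.
From mathcomp Require Import boolp classical_sets reals topology normedtype.
From mathcomp Require Import derive.

Import Order.TTheory GRing.Theory Num.Theory.
Import numFieldNormedType.Exports.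

Local Open Scope ring_scope.
Local Open Scope classical_set_scope.

(* The formula for ad* on a ⋉ a collapses because ad*_{X+Y} N - ad*_X N is
   ad*_Y N.  Stacking it on the coadjoint operator of g ⋉ V gives a map
   satisfying the defining identity of ad*, and nondegeneracy of the pairing
   makes this map the only one.  The equations of motion are then read off
   componentwise, limits in a product being componentwise limits. *)

Section Pairing.
Context {R : realType} {a' a : lmodType R} (P : pairing a' a).

Lemma pair_Dl mu nu x : P (mu + nu) x = P mu x + P nu x.
Proof.
by have := (pair_bilinear P).1 x 1 mu nu; rewrite /= scale1r mul1r.
Qed.

Lemma pair_Dr mu x y : P mu (x + y) = P mu x + P mu y.
Proof.
by have := (pair_bilinear P).2 mu 1 x y; rewrite /= scale1r mul1r.
Qed.

Lemma pair_Nl mu x : P (- mu) x = - P mu x.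
Proof.
by have := (pair_bilinear P).1 x (-1) mu 0; rewrite /= pair0l !addr0
  scaleN1r mulN1r.
Qed.

Lemma pair_Nr mu x : P mu (- x) = - P mu x.
Proof.
by have := (pair_bilinear P).2 mu (-1) x 0; rewrite /= pair0r !addr0
  scaleN1r mulN1r.
Qed.

Lemma pair_injl mu nu : P mu =1 P nu -> mu = nu.
Proof.
move=> eqP; apply/subr0_eq/(pair_nondegl (p := P)) => x.
by rewrite pair_Dl pair_Nl eqP subrr.
Qed.

End Pairing.

(** Carries a formula computed on one explicit operator over to an arbitrary operator satisfying the
    defining identity. *)
Lemma is_coadjoint_uniq {R : realType} {a' a : lmodType R} {B : lieBracket a}
    {P : pairing a' a} {coad1 coad2} :
  is_coadjoint B P coad1 -> is_coadjoint B P coad2 -> coad1 =2 coad2.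
Proof.
by move=> c1P c2P x mu; apply: (pair_injl P) => y; rewrite c1P c2P.
Qed.

Definition semidirect_coad {g V g' V' : nmodType} (ads : g -> g' -> g')
    (alphas : g -> V' -> V') (diamond : V' -> V -> g')
    (x : g * V) (mu : g' * V') : g' * V' :=
  (ads x.1 mu.1 + diamond mu.2 x.2, alphas x.1 mu.2).

(** The bracket with [(y, v)] contributes [alpha x v - alpha y u] in [V]. Pairing with [l], the
    first term gives [alphas x l], and the second gives [diamond l u], whose sign convention absorbs
    the minus. *)
Lemma semidirect_coadP {R : realType} {g V g' V' : lmodType R}
    (B : lieBracket g) (alpha : lieRep B V)
    (Pg : pairing g' g) (PV : pairing V' V) ads alphas diamond :
  is_coadjoint B Pg ads -> is_dual_action alpha PV alphas ->
  is_diamond alpha Pg PV diamond ->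
  is_coadjoint (semidirect alpha) (prod_pairing Pg PV)
    (semidirect_coad ads alphas diamond).
Proof.
move=> adsP alphasP diamondP [x u] [m l] [y v].
rewrite /= /prod_pairing_op /= pair_Dl adsP diamondP alphasP.
by rewrite pair_Dr pair_Nr -addrA [in LHS](addrC (- _)).
Qed.

Definition self_semidirect_coad {a a' : nmodType} (coad : a -> a' -> a')
    (x : a * a) (mu : a' * a') : a' * a' :=
  (coad x.1 mu.1 + coad x.2 mu.2, coad (x.1 + x.2) mu.2).

Lemma self_semidirect_coadP {R : realType} {a a' : lmodType R}
    (B : lieBracket a) (P : pairing a' a) coad :
  is_coadjoint B P coad ->
  is_coadjoint (self_semidirect B) (prod_pairing P P)
    (self_semidirect_coad coad).
Proof.
move=> coadP [x y] [M N] [z w].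
have BB := lie_bilinear B.
rewrite /= /prod_pairing_op /= pair_Dl !coadP -addrA -pair_Dr.
(* No linearity of [coad] is at hand, so the comparison is made on the bracket side. With the [M]
   terms equal, it remains that [[y, z] + [x + y, w] = [x + y, z + w] - [x, z]]. *)
congr (_ + P _ _).
by rewrite !(bil_Dl BB) !(bil_Dr BB) [RHS]addrC -!addrA addKr addrCA.
Qed.

(** The difference quotient of a pair computes to the pair of difference quotients; limits are
    paired in one direction and composed with the continuous projections in the other. *)
Lemma is_curve_derive_pair {R : realType} {W1 W2 : tvsType R}
    (c1 : R -> W1) (c2 : R -> W2) (t : R) (d1 : W1) (d2 : W2) :
  is_curve_derive (fun s => (c1 s, c2 s)) t (d1, d2) <->
  is_curve_derive c1 t d1 /\ is_curve_derive c2 t d2.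
Proof.
split=> [cd|[cd1 cd2]]; last exact: cvg_pair cd1 cd2.
have fst_cont : {for (d1, d2), continuous fst} by exact: cvg_fst.
have snd_cont : {for (d1, d2), continuous snd} by exact: cvg_snd.
split.
  exact: continuous_cvg fst_cont cd.
exact: continuous_cvg snd_cont cd.
Qed.

(** The equation itself determines the existential witness, so it is eliminated without appeal to
    uniqueness of limits. *)
Lemma euler_poincare_atE {R : realType} {a' : tvsType R} {a : lmodType R}
    (coad : a -> a' -> a') (zeta : R -> a) (mu : R -> a') (t : R) :
  euler_poincare_at coad zeta mu t <->
  is_curve_derive mu t (- coad (zeta t) (mu t)).
Proof.
split=> [[dmu cd /eqP]|cd]; first by rewrite addr_eq0 => /eqP <-.
by exists (- coad (zeta t) (mu t)); rewrite ?addNr.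
Qed.

Theorem mainTheorem4 (R : realType) (g V g' V' : tvsType R)
    (B : lieBracket g) (alpha : lieRep B V)
    (Pg : pairing g' g) (PV : pairing V' V)
    (ads : g -> g' -> g') (alphas : g -> V' -> V') (diamond : V' -> V -> g')
    (adsP : is_coadjoint B Pg ads)
    (alphasP : is_dual_action alpha PV alphas)
    (diamondP : is_diamond alpha Pg PV diamond) :
  let gV := semidirect alpha in
  let PgV := prod_pairing Pg PV in
  let A := self_semidirect gV in
  let PA := prod_pairing PgV PgV in
  (exists coad, is_coadjoint A PA coad) /\
  (forall coad : (g * V) * (g * V) -> (g' * V') * (g' * V') ->
                 (g' * V') * (g' * V'),
    is_coadjoint A PA coad ->
    (forall (xih : g) (f : V) (xik : g) (h : V) (m : g') (l : V') (n : g') (o : V'),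
      coad ((xih, f), (xik, h)) ((m, l), (n, o)) =
      ((ads xih m + diamond l f + ads xik n + diamond o h,
        alphas xih l + alphas xik o),
       (ads (xih + xik) n + diamond o (f + h),
        alphas (xih + xik) o))) /\
    (forall (ell : (g * V) * (g * V) -> R) (J : set R)
        (xih : R -> g) (f : R -> V) (xik : R -> g) (h : R -> V)
        (m : R -> g') (l : R -> V') (n : R -> g') (o : R -> V'),
      open J -> is_interval J ->
      let zeta t := ((xih t, f t), (xik t, h t)) in
      let mu t := ((m t, l t), (n t, o t)) in
      (forall t, J t -> curve_derivable zeta t) ->
      (forall t, J t -> is_variational_derivative PA ell (zeta t) (mu t)) ->
      (forall t, J t -> euler_poincare_at coad zeta mu t) <->
      (forall t, J t ->
        [/\ is_curve_derive m t
              (- ads (xih t) (m t) - diamond (l t) (f t)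
               - ads (xik t) (n t) - diamond (o t) (h t)),
            is_curve_derive l t
              (- alphas (xih t) (l t) - alphas (xik t) (o t)),
            is_curve_derive n t
              (- ads (xih t + xik t) (n t) - diamond (o t) (f t + h t)) &
            is_curve_derive o t (- alphas (xih t + xik t) (o t))]))).
Proof.
move=> gV PgV A PA.
pose coad0 := self_semidirect_coad (semidirect_coad ads alphas diamond).
have coad0P : is_coadjoint A PA coad0.
  exact/self_semidirect_coadP/semidirect_coadP.
split; first by exists coad0.
move=> coad coadP.
have coadE xih f xik h m l n o :
    coad ((xih, f), (xik, h)) ((m, l), (n, o)) =
    ((ads xih m + diamond l f + ads xik n + diamond o h,
      alphas xih l + alphas xik o),
     (ads (xih + xik) n + diamond o (f + h), alphas (xih + xik) o)).
  (* [coad0] groups the first component as [(ads xih m + diamond l f) + (ads xik n + diamond o h)],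
     hence the reassociation. *)
  by rewrite (is_coadjoint_uniq coadP coad0P) -(addrA (_ + _)).
split=> // ell J xih f xik h m l n o _ _ zeta mu _ _.
have EPE t : euler_poincare_at coad zeta mu t <->
    [/\ is_curve_derive m t
          (- ads (xih t) (m t) - diamond (l t) (f t)
           - ads (xik t) (n t) - diamond (o t) (h t)),
        is_curve_derive l t (- alphas (xih t) (l t) - alphas (xik t) (o t)),
        is_curve_derive n t
          (- ads (xih t + xik t) (n t) - diamond (o t) (f t + h t)) &
        is_curve_derive o t (- alphas (xih t + xik t) (o t))].
  (* Each right-hand side is folded into the opposite of one component of [coad]; the derivative of
     [mu] is then split at the outer pair and at both inner pairs. *)
  rewrite -!opprD euler_poincare_atE coadE !is_curve_derive_pair.
  by split=> [[[? ?] [? ?]]|[]].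
by split=> EP t Jt; apply/EPE/EP.
Qed.
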